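(* Let $M(A,Q,g)$ be a weak almost Hermitian manifold with fundamental 2-form $F$, considered as a generalized Riemannian manifold $(M,G=g+F)$. Suppose that $\nabla$ is an Einstein's connection on $(M,G)$ with totally skew-symmetric torsion $(0,3)$-tensor $T$. If the $A$-torsion condition $T(AX,Y)=T(X,AY)$ (for all $X,Y\in\mathfrak X_M$) holds, then for all vector fields $X,Y,Z$ $$T(AX,Y,Z)=-\frac13\,dF(AX,Y,Z)=-\frac14\,N_A(X,Y,Z),$$ $$\nabla Q=\nabla^gQ=0,$$ and $M(A,Q,g)$ is a weak nearly K\''ahler manifold.
   Context: A weak almost Hermitian manifold $M(A,Q,g)$ is a Riemannian manifold $(M,g)$ of dimension $n=2m\ge 4$ endowed with non-singular endomorphisms $A$ ($g$-skew-symmetric) and $Q$ ($g$-self-adjoint) of $TM$ and a fundamental 2-form $F$ such that $A^2=-Q$, $g(AX,AY)=g(QX,Y)$, $F(X,Y)=g(AX,Y)$. It is weak nearly K\''ahler if $(\nabla^g_XA)X=0$ for all $X$, where $\nabla^g$ is the Levi-Civita connection of $g$. $\mathfrak X_M$ is the set of smooth vector fields on $M$. Put $G=g+F$ (a non-symmetric $(0,2)$-tensor). For a linear connection $\nabla$, the torsion is $T(X,Y)=\nabla_XY-\nabla_YX-[X,Y]$ and $T(X,Y,Z):=g(T(X,Y),Z)$. An Einstein's connection is a linear connection $\nabla$ satisfying the Einstein metricity condition $XG(Y,Z)-G(\nabla_YX,Z)-G(Y,\nabla_XZ)=0$ for commuting vector fields $X,Y$; equivalently, $(\nabla_XG)(Y,Z)=-G(T(X,Y),Z)$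 for all $X,Y,Z$. The torsion is totally skew-symmetric if $T(X,Y,Z)$ is skew-symmetric in all arguments. The Nijenhuis tensor is $N_A(X,Y)=[AX,AY]+A^2[X,Y]-A[AX,Y]-A[X,AY]$, with $N_A(X,Y,Z):=g(N_A(X,Y),Z)$. The exterior derivative is normalized without the factor $\frac13$: for pairwise commuting vector fields, $dF(X,Y,Z)=X(F(Y,Z))+Y(F(Z,X))+Z(F(X,Y))$. *)

(* Defs.v *)
From HB Require Import structures.
From mathcomp Require Import all_boot all_order all_algebra.
From mathcomp Require Import all_classical all_reals all_analysis.
From mathcomp Require Import ring.
Import numFieldNormedType.Exports.

Set Implicit Arguments.
Unset Strict Implicit.
Unset Printing Implicit Defensive.

Import Order.TTheory GRing.Theory Num.Theory.
Local Open Scope classical_set_scope.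
Local Open Scope ring_scope.

Section EuclideanSmoothness.
Variables (R : realType) (n : nat).
Implicit Types (U : set 'rV[R]_n) (f g : 'rV[R]_n -> R).

Fixpoint Ck_on (k : nat) U f : Prop :=
  (forall x, U x -> {for x, continuous f}) /\
  if k is k'.+1 then
    forall v, (forall x, U x -> derivable f x v) /\ Ck_on k' U ('D_v f)
  else True.

(* Only used for open [U]. *)
Definition smooth_on U f : Prop := forall k, Ck_on k U f.

Lemma Ck_onW k U f : Ck_on k.+1 U f -> Ck_on k U f.
Proof.
elim: k f => [|k IH] f; first by case=> fc _; split.
case=> fc fD; split => // v; have [fv fDv] := fD v.
by split => //; apply: IH.
Qed.

Lemma near_open U f g x : open U -> (forall x, U x -> f x = g x) -> U x ->
  \forall y \near nbhs x, f y = g y.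
Proof.
by move=> oU fg Ux; apply: filterS fg (open_nbhs_nbhs (conj oU Ux)).
Qed.

Lemma continuous_on_ext U f g : open U -> (forall x, U x -> f x = g x) ->
  (forall x, U x -> {for x, continuous f}) ->
  forall x, U x -> {for x, continuous g}.
Proof.
move=> oU fg fc x Ux; rewrite /prop_for /continuous_at -(fg _ Ux).
exact: cvg_trans (@near_eq_cvg _ _ (nbhs x) _ f g (near_open oU fg Ux))
  (fc x Ux).
Qed.

Lemma Ck_on_ext k U f g : open U -> (forall x, U x -> f x = g x) ->
  Ck_on k U f -> Ck_on k U g.
Proof.
move=> oU; elim: k f g => [|k IH] f g fg [fc fD]; split=> //.
- exact: continuous_on_ext fc.
- exact: continuous_on_ext fc.
move=> v; have [fv fDv] := fD v; split.
- by move=> x Ux; exact: near_eq_derivable (near_open oU fg Ux) (fv x Ux).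
- by apply: IH fDv => x Ux; exact: near_eq_derive (near_open oU fg Ux).
Qed.

Lemma Ck_on_cst k U (c : R) : open U -> Ck_on k U (fun=> c).
Proof.
move=> oU; elim: k c => [|k IH] c.
  by split => // x _; exact: cst_continuous.
split; first by move=> x _; exact: cst_continuous.
move=> v; split; first by move=> x _; exact: derivable_cst.
apply: (Ck_on_ext oU _ (IH 0)) => x _.
by rewrite derive_cst.
Qed.

Lemma Ck_onD k U f g : open U -> Ck_on k U f -> Ck_on k U g ->
  Ck_on k U (f + g).
Proof.
move=> oU; elim: k f g => [|k IH] f g [fc fD] [gc gD].
  by split => // x Ux; exact: continuousD (fc x Ux) (gc x Ux).
split; first by move=> x Ux; exact: continuousD (fc x Ux) (gc x Ux).
move=> v; have [fv fDv] := fD v; have [gv gDv] := gD v; split.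
  by move=> x Ux; exact: derivableD (fv x Ux) (gv x Ux).
apply: (Ck_on_ext oU _ (IH _ _ fDv gDv)) => x Ux.
by rewrite (deriveD (fv x Ux) (gv x Ux)).
Qed.

Lemma Ck_onM k U f g : open U -> Ck_on k U f -> Ck_on k U g ->
  Ck_on k U (f * g).
Proof.
move=> oU; elim: k f g => [|k IH] f g Hf Hg.
  have [fc _] := Hf; have [gc _] := Hg.
  by split => // x Ux; exact: continuousM (fc x Ux) (gc x Ux).
have [fc fD] := Hf; have [gc gD] := Hg.
split; first by move=> x Ux; exact: continuousM (fc x Ux) (gc x Ux).
move=> v; have [fv fDv] := fD v; have [gv gDv] := gD v; split.
  by move=> x Ux; exact: derivableM (fv x Ux) (gv x Ux).
apply: (Ck_on_ext oU _ (Ck_onD oU (IH _ _ (Ck_onW Hf) gDv)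
  (IH _ _ (Ck_onW Hg) fDv))) => x Ux.
by rewrite (deriveM (fv x Ux) (gv x Ux)).
Qed.

End EuclideanSmoothness.

(* A chart is a partial homeomorphism between open sets; [chart_inv] is its
   inverse, both maps having junk values off the chart. *)
Record chart (R : realType) (n : nat) (M : topologicalType) := Chart {
  chart_dom : set M;
  chart_map : M -> 'rV[R]_n;
  chart_inv : 'rV[R]_n -> M;
  chart_open : open chart_dom;
  chart_img_open : open (chart_map @` chart_dom);
  chart_mapK : {in chart_dom, cancel chart_map chart_inv};
  chart_map_cont : {within chart_dom, continuous chart_map};
  chart_inv_cont : {within chart_map @` chart_dom, continuous chart_inv} }.

Definition chart_img R n M (c : @chart R n M) : set 'rV[R]_n :=
  chart_map c @` chart_dom c.

Record smoothManifold (R : realType) (n : nat) := SmoothManifold {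
  carrier :> topologicalType;
  atlas : set (chart R n carrier);
  mfd_hausdorff : hausdorff_space carrier;
  mfd_second_countable : @second_countable carrier;
  mfd_cover : \bigcup_(c in atlas) chart_dom c = setT;
  mfd_compat : forall c c', atlas c -> atlas c' -> forall j : 'I_n,
    smooth_on (chart_map c @` (chart_dom c `&` chart_dom c'))
              (fun x => chart_map c' (chart_inv c x) ord0 j) }.

Section SmoothFunctions.
Variables (R : realType) (n : nat) (M : smoothManifold R n).

Definition smooth (f : M -> R) : Prop :=
  forall c, atlas c -> smooth_on (chart_img c) (f \o chart_inv c).

Lemma smooth_cst (a : R) : smooth (fun=> a).
Proof. by move=> c _ k; apply: Ck_on_cst; exact: chart_img_open. Qed.

Lemma smoothD f g : smooth f -> smooth g -> smooth (f + g).
Proof.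
move=> sf sg c ac k; apply: Ck_onD; [exact: chart_img_open|exact: sf|exact: sg].
Qed.

Lemma smoothM f g : smooth f -> smooth g -> smooth (f * g).
Proof.
move=> sf sg c ac k; apply: Ck_onM; [exact: chart_img_open|exact: sf|exact: sg].
Qed.

Definition smooth_pred : {pred M -> R} := fun f => `[< smooth f >].

Record smoothFun := SmoothFun {
  smoothFun_val :> M -> R; _ : smoothFun_val \in smooth_pred }.

HB.instance Definition _ := [isSub of smoothFun for smoothFun_val].
HB.instance Definition _ := [Choice of smoothFun by <:].

Lemma smooth_subring_closed : subring_closed smooth_pred.
Proof.
split; first exact/asboolP/smooth_cst.
- move=> f g /asboolP sf /asboolP sg; apply/asboolP.
  have -> : f - g = f + (fun=> -1) * g.
    by apply/funext => x; rewrite /GRing.add /GRing.mul /= mulN1r.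
  by apply: smoothD => //; apply: smoothM => //; exact: smooth_cst.
- by move=> f g /asboolP sf /asboolP sg; apply/asboolP; exact: smoothM.
Qed.
HB.instance Definition _ := GRing.SubChoice_isSubComPzRing.Build
  (M -> R) smooth_pred smoothFun smooth_subring_closed.

Lemma smoothFunP (f g : smoothFun) : (forall p, f p = g p) -> f = g.
Proof. by move=> fg; apply/val_inj/funext. Qed.

Lemma smoothFun_addE (f g : smoothFun) p : (f + g) p = f p + g p.
Proof. by []. Qed.
Lemma smoothFun_oppE (f : smoothFun) p : (- f) p = - f p.
Proof. by []. Qed.
Lemma smoothFun_mulE (f g : smoothFun) p : (f * g) p = f p * g p.
Proof. by []. Qed.
Lemma smoothFun_zeroE p : (0 : smoothFun) p = 0.
Proof. by []. Qed.
Lemma smoothFun_oneE p : (1 : smoothFun) p = 1.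
Proof. by []. Qed.

Fact smoothFun_scale_subproof (a : R) (f : smoothFun) :
  (fun p => a * f p) \in smooth_pred.
Proof.
apply/asboolP/(@smoothM (fun=> a)); first exact: smooth_cst.
by case: f => f /= /asboolP.
Qed.
Definition smoothFun_scale a f := SmoothFun (smoothFun_scale_subproof a f).

Fact smoothFun_scaleA a b f :
  smoothFun_scale a (smoothFun_scale b f) = smoothFun_scale (a * b) f.
Proof. by apply: smoothFunP => p /=; rewrite mulrA. Qed.
Fact smoothFun_scale1 : left_id 1 smoothFun_scale.
Proof. by move=> f; apply: smoothFunP => p /=; rewrite mul1r. Qed.
Fact smoothFun_scaleDr : right_distributive smoothFun_scale +%R.
Proof. by move=> a f g; apply: smoothFunP => p; exact: mulrDr. Qed.
Fact smoothFun_scaleDl f :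
  {morph smoothFun_scale^~ f : a b / a + b >-> a + b}.
Proof. by move=> a b; apply: smoothFunP => p; exact: mulrDl. Qed.
HB.instance Definition _ := GRing.Zmodule_isLmodule.Build R smoothFun
  smoothFun_scaleA smoothFun_scale1 smoothFun_scaleDr smoothFun_scaleDl.

Lemma smoothFun_scaleE (a : R) (f : smoothFun) p : (a *: f) p = a * f p.
Proof. by []. Qed.

End SmoothFunctions.

(* Smooth vector fields are the derivations of the algebra of smooth functions:
   the tangent vector of [X] at [p] is the point derivation [f |-> X f p]. *)
Record vectorField R n (M : @smoothManifold R n) := VectorField {
  vf_fun :> smoothFun M -> smoothFun M;
  vf_linear : linear vf_fun;
  vf_leibniz : forall f h, vf_fun (f * h) = vf_fun f * h + f * vf_fun h }.

HB.instance Definition _ R n (M : @smoothManifold R n) (X : vectorField M) :=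
  GRing.isLinear.Build R (smoothFun M) (smoothFun M) *:%R (vf_fun X)
    (vf_linear X).
HB.instance Definition _ R n (M : @smoothManifold R n) :=
  gen_eqMixin (vectorField M).
HB.instance Definition _ R n (M : @smoothManifold R n) :=
  gen_choiceMixin (vectorField M).

Section VectorFields.
Variables (R : realType) (n : nat) (M : smoothManifold R n).
Local Notation Cinf := (smoothFun M).
Local Notation vf := (vectorField M).
Implicit Types (f h : Cinf) (X Y : vf).

Lemma vectorFieldP X Y : (forall f, X f = Y f) -> X = Y.
Proof.
case: X Y => [X X1 X2] [Y Y1 Y2] /= XY.
have XYe : X = Y by apply/funext.
by subst Y; congr VectorField; exact: Prop_irrelevance.
Qed.

Local Obligation Tactic := idtac.

Program Definition vf_zero : vf := @VectorField _ _ _ (fun=> 0) _ _.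
Next Obligation. by move=> a f h; rewrite scaler0 addr0. Qed.
Next Obligation. by move=> f h; rewrite mul0r mulr0 addr0. Qed.

Program Definition vf_opp X : vf := @VectorField _ _ _ (fun f => - X f) _ _.
Next Obligation. by move=> X a f h /=; rewrite linearP opprD scalerN. Qed.
Next Obligation. by move=> X f h /=; rewrite vf_leibniz opprD mulNr mulrN. Qed.

Program Definition vf_add X Y : vf :=
  @VectorField _ _ _ (fun f => X f + Y f) _ _.
Next Obligation. by move=> X Y a f h /=; rewrite !linearP scalerDr addrACA. Qed.
Next Obligation.
by move=> X Y f h /=; rewrite !vf_leibniz mulrDl mulrDr addrACA.
Qed.

Fact scale_mulr (a : R) f h : a *: (f * h) = f * (a *: h).
Proof. by apply: smoothFunP => p; exact: mulrCA. Qed.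

Program Definition vf_scale f X : vf :=
  @VectorField _ _ _ (fun h => f * X h) _ _.
Next Obligation. by move=> f X a h k /=; rewrite linearP mulrDr scale_mulr. Qed.
Next Obligation.
by move=> f X h k /=; rewrite vf_leibniz mulrDr mulrA; congr (_ + _); exact: mulrCA.
Qed.

Fact vf_addA : associative vf_add.
Proof. by move=> X Y Z; apply: vectorFieldP => f; exact: addrA. Qed.
Fact vf_addC : commutative vf_add.
Proof. by move=> X Y; apply: vectorFieldP => f; exact: addrC. Qed.
Fact vf_add0 : left_id vf_zero vf_add.
Proof. by move=> X; apply: vectorFieldP => f; exact: add0r. Qed.
Fact vf_addN : left_inverse vf_zero vf_opp vf_add.
Proof. by move=> X; apply: vectorFieldP => f; exact: addNr. Qed.
HB.instance Definition _ :=
  GRing.isZmodule.Build vf vf_addA vf_addC vf_add0 vf_addN.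

Fact vf_scaleA f h X : vf_scale f (vf_scale h X) = vf_scale (f * h) X.
Proof. by apply: vectorFieldP => k; exact: mulrA. Qed.
Fact vf_scale1 : left_id 1 vf_scale.
Proof. by move=> X; apply: vectorFieldP => k; exact: mul1r. Qed.
Fact vf_scaleDr : right_distributive vf_scale +%R.
Proof. by move=> f X Y; apply: vectorFieldP => k; exact: mulrDr. Qed.
Fact vf_scaleDl X : {morph vf_scale^~ X : f h / f + h >-> f + h}.
Proof. by move=> f h; apply: vectorFieldP => k; exact: mulrDl. Qed.
HB.instance Definition _ := GRing.Zmodule_isLmodule.Build Cinf vf
  vf_scaleA vf_scale1 vf_scaleDr vf_scaleDl.

Program Definition lie X Y : vf :=
  @VectorField _ _ _ (fun f => X (Y f) - Y (X f)) _ _.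
Next Obligation.
by move=> X Y a f h /=; rewrite !linearP /= scalerBr scalerN addrACA.
Qed.
Next Obligation.
move=> X Y f h /=; rewrite !vf_leibniz.
rewrite (linearD X) (linearD Y) /= !vf_leibniz; apply: smoothFunP => p.
rewrite !(smoothFun_addE, smoothFun_oppE, smoothFun_mulE).
ring.
Qed.

Definition vanishes_at X (p : M) : Prop := forall f, X f p = 0.

End VectorFields.

Section Geometry.
Variables (R : realType) (n : nat) (M : smoothManifold R n).
Local Notation Cinf := (smoothFun M).
Local Notation vf := (vectorField M).
Implicit Types (X Y Z : vf) (g G F : vf -> vf -> Cinf) (D : vf -> vf -> vf).
Implicit Types (A Q : {linear vf -> vf}).

(* Tensor fields are the maps on vector fields that are linear over the ring of
   smooth functions. In particular an endomorphism field of the tangent bundle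
   is a [{linear vf -> vf}]. *)

Record riemannian_metric g : Prop := RiemannianMetric {
  metric_sym : forall X Y, g X Y = g Y X;
  metric_linear : forall (f : Cinf) X Y Z,
    g (f *: X + Y) Z = f * g X Z + g Y Z;
  metric_pos : forall X p, ~ vanishes_at X p -> 0 < g X X p }.

(* Trivial kernel on every (finite-dimensional) tangent space. *)
Definition nonsingular A : Prop :=
  forall X p, vanishes_at (A X) p -> vanishes_at X p.

Record weak_almost_hermitian A Q g : Prop := WeakAlmostHermitian {
  wah_metric : riemannian_metric g;
  wah_A_nonsingular : nonsingular A;
  wah_Q_nonsingular : nonsingular Q;
  wah_A_skew : forall X Y, g (A X) Y = - g X (A Y);
  wah_Q_selfadjoint : forall X Y, g (Q X) Y = g X (Q Y);
  wah_A_square : forall X, A (A X) = - Q X;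
  wah_compat : forall X Y, g (A X) (A Y) = g (Q X) Y }.

Definition fundamental_form g A X Y : Cinf := g (A X) Y.

Record linear_connection D : Prop := LinearConnection {
  conn_linear : forall (f : Cinf) X Y Z,
    D (f *: X + Y) Z = f *: D X Z + D Y Z;
  conn_add : forall X Y Z, D X (Y + Z) = D X Y + D X Z;
  conn_leibniz : forall X (f : Cinf) Y, D X (f *: Y) = X f *: Y + f *: D X Y }.

Definition torsion D X Y : vf := D X Y - D Y X - lie X Y.
Definition torsion3 g D X Y Z : Cinf := g (torsion D X Y) Z.

Definition nabla_form D G X Y Z : Cinf :=
  X (G Y Z) - G (D X Y) Z - G Y (D X Z).
Definition nabla_endo D A X Y : vf := D X (A Y) - A (D X Y).

Definition levi_civita g D : Prop :=
  [/\ linear_connection D,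
      forall X Y, torsion D X Y = 0 &
      forall X Y Z, nabla_form D g X Y Z = 0].

Definition weak_nearly_kahler A Q g D : Prop :=
  [/\ weak_almost_hermitian A Q g, levi_civita g D &
      forall X, nabla_endo D A X X = 0].

(* Einstein metricity in tensorial form; see [einstein_metricity_commuting]. *)
Definition einstein_connection G D : Prop :=
  linear_connection D /\
  forall X Y Z, nabla_form D G X Y Z = - G (torsion D X Y) Z.

Lemma einstein_metricity_commuting G D X Y Z :
  (forall Z, {morph G^~ Z : X Y / X + Y >-> X + Y}) -> lie X Y = 0 ->
  nabla_form D G X Y Z = - G (torsion D X Y) Z <->
  X (G Y Z) - G (D Y X) Z - G Y (D X Z) = 0.
Proof.
move=> GD XY0; rewrite /nabla_form.
have -> : D X Y = D Y X + torsion D X Y.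
  by rewrite /torsion XY0 subr0 addrC subrK.
rewrite GD opprD addrA [_ - G Y _]addrAC; split=> [e|->]; last exact: add0r.
by rewrite -[LHS](subrK (G (torsion D X Y) Z)) e addNr.
Qed.

Definition totally_skew (T : vf -> vf -> vf -> Cinf) : Prop :=
  forall X Y Z, T Y X Z = - T X Y Z /\ T X Z Y = - T X Y Z.

Definition nijenhuis A X Y : vf :=
  lie (A X) (A Y) + A (A (lie X Y)) - A (lie (A X) Y) - A (lie X (A Y)).
Definition nijenhuis3 g A X Y Z : Cinf := g (nijenhuis A X Y) Z.

(* Exterior derivative of a 2-form, without the factor 1/3. *)
Definition ext_d F X Y Z : Cinf :=
  X (F Y Z) + Y (F Z X) + Z (F X Y)
  - F (lie X Y) Z - F (lie Y Z) X - F (lie Z X) Y.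

End Geometry.

(* Main.v *)
Require Import Defs.
From HB Require Import structures.
From mathcomp Require Import all_boot all_order all_algebra.
From mathcomp Require Import all_classical all_reals all_analysis.
From mathcomp Require Import ring lra.

(** Write [T] for the torsion of the Einstein connection. Its total skewness
    turns the condition [T (A X) Y = T X (A Y)] into [A (T X Y) = - T X (A Y)]
    ([A_torsion]), and after that the whole theorem is the algebra of moving
    [A] through [T].

    The Einstein equation [(nabla_X G)(Y, Z) = - G (T X Y) Z] for [G = g + F]
    splits into its parts symmetric and skew in [Y, Z]. On the right,
    [G (T X Y) Z = g (T X Y) Z - g (T X (A Y)) Z] is entirely skew. Hence the
    symmetric part says that [nabla g = 0] ([einstein_metric]), and the skew
    part computes [nabla A] ([einstein_nabla_A]).

    A metric connection with totally skew torsion differs from the Levi-Civita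
    connection by exactly half its torsion ([metric_connection_skew_torsion]).
    Transporting the formula for [nabla A] along this difference gives
    [(nablag_X A) Y = - T X Y] ([levi_civita_nabla_A]), which is skew in
    [X, Y]: this is the weak nearly Kaehler condition. Since [Q = - A ^ 2],
    both [nabla Q] and [nablag Q] follow by the Leibniz rule, and the terms
    cancel by [A_torsion]. Finally [dF] and the Nijenhuis tensor are expressed
    through [nablag A] because [nablag] has no torsion; substituting
    [- T] gives [dF = - 3 T] and [N (X, Y) = - 4 T (A X) Y]. *)

Import Order.TTheory GRing.Theory Num.Theory.
Local Open Scope ring_scope.

(** * Evaluating identities between functions and vector fields *)

Section VectorFieldIdentities.
Context {R : realType} {n : nat} {M : smoothManifold R n}.
Local Notation vf := (vectorField M).

Lemma vf_addE (X Y : vf) f : (X + Y) f = X f + Y f.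
Proof. by []. Qed.

Lemma vf_oppE (X : vf) f : (- X) f = - X f.
Proof. by []. Qed.

Lemma vf_zeroE f : (0 : vf) f = 0.
Proof. by []. Qed.

Lemma smoothFun_mulrnE (f : smoothFun M) k p : (f *+ k) p = f p *+ k.
Proof. by elim: k => // k IHk; rewrite !mulrS smoothFun_addE IHk. Qed.

(** Statements about one half of the torsion are phrased by doubling, so as to
    stay inside the module of vector fields over the smooth functions; this
    lemma and the next one undo the doubling. *)
Lemma smoothFun_double_inj (f h : smoothFun M) : f + f = h + h -> f = h.
Proof.
move=> e; apply: smoothFunP => p.
have := congr1 (fun k : smoothFun M => k p) e; rewrite !smoothFun_addE; lra.
Qed.

Lemma vf_double_inj (X Y : vf) : X + X = Y + Y -> X = Y.
Proof.
move=> e; apply: vectorFieldP => f; apply: smoothFun_double_inj.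
by rewrite -!vf_addE e.
Qed.

End VectorFieldIdentities.

(** Evaluating at a function and at a point reduces an additive identity between
    vector fields to one between real numbers. *)
Ltac scalar_ring :=
  apply: smoothFunP => ?;
  rewrite ?(smoothFun_addE, smoothFun_oppE, smoothFun_mulE, smoothFun_zeroE);
  ring.

Ltac vector_ring :=
  apply: vectorFieldP => ?; rewrite ?(vf_addE, vf_oppE, vf_zeroE); scalar_ring.

Ltac scalar_lra :=
  let p := fresh "p" in apply: smoothFunP; intro p;
  repeat match goal with H : @eq (smoothFun _) _ _ |- _ =>
    move: (congr1 (fun k => smoothFun_val k p) H); clear H
  end;
  rewrite ?(smoothFun_scaleE, smoothFun_mulrnE, smoothFun_addE,
            smoothFun_oppE, smoothFun_zeroE);
  lra.

(** * Metrics and connections *)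

Section Metric.
Context {R : realType} {n : nat} {M : smoothManifold R n}.
Local Notation vf := (vectorField M).
Context {g : vf -> vf -> smoothFun M} (gP : riemannian_metric g).

Lemma metricDl X Y Z : g (X + Y) Z = g X Z + g Y Z.
Proof. by have := metric_linear gP 1 X Y Z; rewrite scale1r mul1r. Qed.

Lemma metric0l Z : g 0 Z = 0.
Proof. by apply: (addrI (g 0 Z)); rewrite -metricDl !addr0. Qed.

Lemma metricNl X Z : g (- X) Z = - g X Z.
Proof. by apply: (addrI (g X Z)); rewrite -metricDl !subrr metric0l. Qed.

Lemma metricMnl X Z k : g (X *+ k) Z = g X Z *+ k.
Proof. by elim: k => [|k IHk]; rewrite ?metric0l // !mulrS metricDl IHk. Qed.

(** Positivity applied to [X - Y] itself: it vanishes at every point, and a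
    vector field is determined by its values because it is a derivation. *)
Lemma metric_nondegenerate X Y : (forall Z, g X Z = g Y Z) -> X = Y.
Proof.
move=> e; apply: subr0_eq; apply: vectorFieldP => f; apply: smoothFunP => p.
have [vp|/(metric_pos gP)] := pselect (vanishes_at (X - Y) p); first exact: vp.
by rewrite metricDl metricNl e subrr smoothFun_zeroE ltxx.
Qed.

End Metric.

Section Connections.
Context {R : realType} {n : nat} {M : smoothManifold R n}.
Local Notation vf := (vectorField M).
Context {g : vf -> vf -> smoothFun M} (gP : riemannian_metric g).
Implicit Types (A Q B : {linear vf -> vf}) (D : vf -> vf -> vf).

Lemma conn_opp D X Y : linear_connection D -> D X (- Y) = - D X Y.
Proof.
move=> DP; have D0 : D X 0 = 0.
  by apply: (addrI (D X 0)); rewrite -(conn_add DP) !addr0.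
by apply: (addrI (D X Y)); rewrite -(conn_add DP) !subrr D0.
Qed.

Lemma lie_torsion_free D X Y : torsion D X Y = 0 -> lie X Y = D X Y - D Y X.
Proof. by move/eqP; rewrite /torsion subr_eq0 => /eqP. Qed.

(** The difference [S] of two metric connections is skew in its last two
    arguments, and its skew part in the first two is the torsion. As the torsion
    is totally skew, Koszul's cyclic argument leaves only [2 S = T]. *)
Lemma metric_connection_skew_torsion D Dg X Y :
  levi_civita g Dg -> (forall X Y Z, nabla_form D g X Y Z = 0) ->
  totally_skew (torsion3 g D) ->
  (D X Y - Dg X Y) + (D X Y - Dg X Y) = torsion D X Y.
Proof.
move=> [_ Dg0 Dgm] Dm Tskew.
(* The difference is made opaque, so that bilinearity does not split it. *)
have [S SE] : {S : vf -> vf -> vf | forall U V, S U V = D U V - Dg U V}.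
  by exists (fun U V => D U V - Dg U V).
have Sskew U V W : g (S U V) W = - g (S U W) V.
  have := Dm U V W; have := Dgm U V W; rewrite /nabla_form.
  rewrite !(Defs.metric_sym gP V) => e1 e2.
  rewrite !SE !(metricDl gP, metricNl gP); scalar_lra.
have TE U V : torsion D U V = S U V - S V U.
  rewrite /torsion (lie_torsion_free _ _ _ (Dg0 U V)) !SE; vector_ring.
apply: (metric_nondegenerate gP) => Z.
have := Tskew X Y Z; have := Tskew Z X Y; have := Tskew Y Z X.
rewrite /torsion3 !TE -SE !(metricDl gP, metricNl gP).
rewrite (Sskew X Z Y) (Sskew Y Z X) (Sskew Z Y X) => -[e1 e2] [e3 e4] [e5 e6].
scalar_lra.
Qed.

(** The assumption is metricity at the one triple where it is used: the defect
    [(nabla_X g)(A Y, Z)] is all that separates the two sides. *)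
Lemma nabla_fundamental_form D A X Y Z :
  nabla_form D g X (A Y) Z = 0 ->
  nabla_form D (fundamental_form g A) X Y Z = g (nabla_endo D A X Y) Z.
Proof.
rewrite /nabla_form /nabla_endo /fundamental_form.
rewrite (metricDl gP) (metricNl gP) => e; rewrite -[LHS]subr0 -e; scalar_ring.
Qed.

Lemma nabla_formD D G F X Y Z :
  nabla_form D (fun X Y => G X Y + F X Y) X Y Z =
  nabla_form D G X Y Z + nabla_form D F X Y Z.
Proof. by rewrite /nabla_form raddfD /=; scalar_ring. Qed.

Lemma nabla_form_sym D (G : vf -> vf -> smoothFun M) X Y Z :
  (forall X Y, G X Y = G Y X) ->
  nabla_form D G X Y Z = nabla_form D G X Z Y.
Proof.
move=> GC; rewrite /nabla_form (GC Y Z) (GC _ Z) (GC Y); scalar_ring.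
Qed.

Lemma nabla_form_skew D (G : vf -> vf -> smoothFun M) X Y Z :
  (forall X Y, G X Y = - G Y X) ->
  nabla_form D G X Y Z = - nabla_form D G X Z Y.
Proof.
move=> GC; rewrite /nabla_form (GC Y Z) (GC _ Z) (GC Y) raddfN; scalar_ring.
Qed.

Lemma nabla_endo_change D D' B X Y :
  nabla_endo D B X Y - nabla_endo D' B X Y =
  (D X (B Y) - D' X (B Y)) - B (D X Y - D' X Y).
Proof. by rewrite /nabla_endo (raddfB B) /=; vector_ring. Qed.

(** The Leibniz rule for [Q = - A ^ 2]. *)
Lemma nabla_endo_square D A Q X Y :
  linear_connection D -> (forall X, A (A X) = - Q X) ->
  nabla_endo D Q X Y = - (nabla_endo D A X (A Y) + A (nabla_endo D A X Y)).
Proof.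
move=> DP AA; rewrite /nabla_endo AA (conn_opp _ _ _ DP) (raddfB A) /= AA.
vector_ring.
Qed.

(** Each bracket is a difference of covariant derivatives, so the six terms of
    [d F] regroup, by skewness of [F], as a cyclic sum. *)
Lemma ext_d_torsion_free D (F : vf -> vf -> smoothFun M) X Y Z :
  (forall X Y, torsion D X Y = 0) ->
  (forall X Y Z, F (X - Y) Z = F X Z - F Y Z) ->
  (forall X Y, F Y X = - F X Y) ->
  ext_d F X Y Z =
  nabla_form D F X Y Z + nabla_form D F Y Z X + nabla_form D F Z X Y.
Proof.
move=> D0 FB Fskew; rewrite /ext_d /nabla_form.
rewrite !(lie_torsion_free _ _ _ (D0 _ _)) !FB.
rewrite (Fskew (D X Z)) (Fskew (D Y X)) (Fskew (D Z Y)); scalar_ring.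
Qed.

Lemma nijenhuis_torsion_free D A X Y :
  (forall X Y, torsion D X Y = 0) ->
  nijenhuis A X Y =
  nabla_endo D A (A X) Y - nabla_endo D A (A Y) X
  - A (nabla_endo D A X Y) + A (nabla_endo D A Y X).
Proof.
move=> D0; rewrite /nijenhuis !(lie_torsion_free _ _ _ (D0 _ _)).
rewrite /nabla_endo !raddfB /=; vector_ring.
Qed.

End Connections.

(** * Einstein connections satisfying the A-torsion condition *)

Section EinsteinATorsion.
Context {R : realType} {n : nat} {M : smoothManifold R n}.
Local Notation vf := (vectorField M).
Context {g : vf -> vf -> smoothFun M} {A Q : {linear vf -> vf}}.
Context {nablag nabla : vf -> vf -> vf}.
Hypothesis wah : weak_almost_hermitian A Q g.
Hypothesis nablagP : levi_civita g nablag.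
Hypothesis nablaP :
  einstein_connection (fun X Y => g X Y + fundamental_form g A X Y) nabla.
Hypothesis Tskew : totally_skew (torsion3 g nabla).
Hypothesis TA : forall X Y, torsion nabla (A X) Y = torsion nabla X (A Y).
Let gP := wah_metric wah.
Local Notation T := (torsion nabla).
Let nabla_conn : linear_connection nabla := proj1 nablaP.

Lemma torsionC X Y : T Y X = - T X Y.
Proof.
apply: (metric_nondegenerate gP) => Z; rewrite (metricNl gP).
by have [] := Tskew X Y Z.
Qed.

(** Both sides pair with [Z] to the torsion form with one [A] inserted. By total
    skewness the A-torsion condition moves [A] between any two arguments, and
    skewness of [A] for [g] brings in the sign. *)
Lemma A_torsion X Y : A (T X Y) = - T X (A Y).
Proof.
apply: (metric_nondegenerate gP) => Z; rewrite (wah_A_skew wah) (metricNl gP).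
have [_] := Tskew X (A Z) Y; have [_] := Tskew (A X) Z Y.
by rewrite /torsion3 !TA => -> ->.
Qed.

Lemma fundamental_form_skew X Y :
  fundamental_form g A X Y = - fundamental_form g A Y X.
Proof.
by rewrite /fundamental_form (wah_A_skew wah) (Defs.metric_sym gP).
Qed.

(** The part of the Einstein equation symmetric in the last two arguments. Both
    [T] and [A] applied to [T] contribute forms that are skew there, so nothing
    remains on the right. *)
Lemma einstein_metric X Y Z : nabla_form nabla g X Y Z = 0.
Proof.
have A3 U V W : g (A (T U V)) W = - g (A (T U W)) V.
  rewrite A_torsion (wah_A_skew wah) (metricNl gP) opprK.
  by have [_] := Tskew U W (A V); rewrite /torsion3 => ->; rewrite opprK.
have := proj2 nablaP X Z Y; have := proj2 nablaP X Y Z; rewrite !nabla_formD.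
rewrite (nabla_form_sym _ _ _ Z Y (Defs.metric_sym gP)).
rewrite (nabla_form_skew _ _ _ Z Y fundamental_form_skew) /fundamental_form.
rewrite (A3 X Z Y); have := proj2 (Tskew X Y Z); rewrite /torsion3 => -> e1 e2.
scalar_lra.
Qed.

(** With [nabla g = 0] the Einstein equation only involves [nabla F], that is,
    [nabla A]. *)
Lemma einstein_nabla_A X Y :
  nabla_endo nabla A X Y = T X (A Y) - T X Y.
Proof.
apply: (metric_nondegenerate gP) => Z.
have := proj2 nablaP X Y Z; rewrite nabla_formD einstein_metric add0r.
rewrite (nabla_fundamental_form gP _ _ _ _ _ (einstein_metric _ _ _)) => ->.
rewrite /fundamental_form A_torsion !(metricDl gP, metricNl gP); scalar_ring.
Qed.

(** Passing from [nabla] to [nablag] removes half of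
    [T X (A Y) - A (T X Y) = 2 T X (A Y)], which is exactly the first term of
    [einstein_nabla_A]. *)
Lemma levi_civita_nabla_A X Y : nabla_endo nablag A X Y = - T X Y.
Proof.
have S2 U V :=
  metric_connection_skew_torsion gP nabla nablag U V nablagP einstein_metric
    Tskew.
have e : nabla_endo nabla A X Y - nabla_endo nablag A X Y = T X (A Y).
  apply: vf_double_inj; rewrite nabla_endo_change addrACA -opprD -(raddfD A).
  by rewrite !S2 /= A_torsion opprK.
have -> : nabla_endo nablag A X Y = nabla_endo nabla A X Y - T X (A Y).
  by rewrite -e; vector_ring.
by rewrite einstein_nabla_A; vector_ring.
Qed.

Lemma einstein_nabla_Q X Y : nabla_endo nabla Q X Y = 0.
Proof.
rewrite (nabla_endo_square _ A _ _ _ nabla_conn (wah_A_square wah)).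
rewrite !einstein_nabla_A (raddfB A) /= !A_torsion; vector_ring.
Qed.

Lemma levi_civita_nabla_Q X Y : nabla_endo nablag Q X Y = 0.
Proof.
have [nablag_conn _ _] := nablagP.
rewrite (nabla_endo_square _ A _ _ _ nablag_conn (wah_A_square wah)).
rewrite !levi_civita_nabla_A (raddfN A) /= A_torsion; vector_ring.
Qed.

Lemma ext_d_torsion X Y Z :
  ext_d (fundamental_form g A) X Y Z = - torsion3 g nabla X Y Z *+ 3.
Proof.
have [_ nablag0 nablag_metric] := nablagP.
rewrite (ext_d_torsion_free nablag) //; first last.
- by move=> U V; rewrite fundamental_form_skew.
- by move=> U V W; rewrite /fundamental_form (raddfB A) /= (metricDl gP)
    (metricNl gP).
rewrite !(nabla_fundamental_form gP _ _ _ _ _ (nablag_metric _ _ _)).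
rewrite !levi_civita_nabla_A !(metricNl gP) -!/(torsion3 g nabla _ _ _).
have -> : torsion3 g nabla Y Z X = torsion3 g nabla X Y Z.
  by rewrite (Tskew Y X Z).2 (Tskew X Y Z).1 opprK.
have -> : torsion3 g nabla Z X Y = torsion3 g nabla X Y Z.
  by rewrite (Tskew X Z Y).1 (Tskew X Y Z).2 opprK.
by rewrite !mulrS mulr0n addr0 addrA.
Qed.

Lemma nijenhuis_torsion X Y : nijenhuis A X Y = - T (A X) Y *+ 4.
Proof.
have [_ nablag0 _] := nablagP.
rewrite (nijenhuis_torsion_free nablag) // !levi_civita_nabla_A !(raddfN A) /=.
rewrite (torsionC X Y) (raddfN A) /= A_torsion (torsionC X (A Y)) -TA.
rewrite !mulrS mulr0n; vector_ring.
Qed.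

End EinsteinATorsion.

Theorem theorem3p5 (R : realType) (m : nat) (hm : (2 <= m)%N)
  (M : smoothManifold R (2 * m))
  (g : vectorField M -> vectorField M -> smoothFun M)
  (A Q : {linear vectorField M -> vectorField M})
  (nablag nabla : vectorField M -> vectorField M -> vectorField M) :
  weak_almost_hermitian A Q g ->
  levi_civita g nablag ->
  einstein_connection (fun X Y => g X Y + fundamental_form g A X Y) nabla ->
  totally_skew (torsion3 g nabla) ->
  (forall X Y, torsion nabla (A X) Y = torsion nabla X (A Y)) ->
  [/\ forall X Y Z,
        torsion3 g nabla (A X) Y Z
          = - (3^-1 : R) *: ext_d (fundamental_form g A) (A X) Y Z /\
        - (3^-1 : R) *: ext_d (fundamental_form g A) (A X) Y Z
          = - (4^-1 : R) *: nijenhuis3 g A X Y Z,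
      forall X Y, nabla_endo nabla Q X Y = 0,
      forall X Y, nabla_endo nablag Q X Y = 0 &
      weak_nearly_kahler A Q g nablag].
Proof.
move=> wah nablagP nablaP Tskew TA; have gP := wah_metric wah.
have dF X Y Z : torsion3 g nabla X Y Z =
    - (3^-1 : R) *: ext_d (fundamental_form g A) X Y Z.
  by rewrite (ext_d_torsion wah nablagP nablaP Tskew TA); scalar_lra.
have N X Y Z : torsion3 g nabla (A X) Y Z =
    - (4^-1 : R) *: nijenhuis3 g A X Y Z.
  rewrite /nijenhuis3 (nijenhuis_torsion wah nablagP nablaP Tskew TA).
  rewrite (metricMnl gP) (metricNl gP) /torsion3; scalar_lra.
split.
- by move=> X Y Z; split; rewrite -dF.
- exact: (einstein_nabla_Q wah nablaP Tskew TA).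
- exact: (levi_civita_nabla_Q wah nablagP nablaP Tskew TA).
split=> // X; rewrite (levi_civita_nabla_A wah nablagP nablaP Tskew TA).
apply: vf_double_inj; rewrite {2}(torsionC wah Tskew X X); vector_ring.
Qed.
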